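(* Let $n$ be a positive integer, let $F$ be a field, and let $$f(x_1,\ldots,x_n)=a_1x_1^k+\cdots+a_nx_n^k+g(x_1,\ldots,x_n)\in F[x_1,\ldots,x_n],$$ where $k$ is a positive integer, $a_1,\ldots,a_n\in F^*$ and $\deg g<k$. Let $P(x_1,\ldots,x_n)$ be a polynomial over $F$ with $[x_1^{k_1}\cdots x_n^{k_n}]P(x_1,\ldots,x_n)\neq 0$, where $k_1,\ldots,k_n$ are nonnegative integers with $k_1+\cdots+k_n=\deg P$. Let $A_1,\ldots,A_n$ be finite subsets of $F$ with $|A_i|>k_i$ for $i=1,\ldots,n$. Then, for the restricted value set $$V=\{f(x_1,\ldots,x_n):\ x_1\in A_1,\ldots,x_n\in A_n,\ \text{and}\ P(x_1,\ldots,x_n)\neq 0\},$$ we have $$|V|\geqslant\min\left\{p(F)-\sum_{i=1}^n\left\lfloor\frac{k_i}{k}\right\rfloor,\ \sum_{i=1}^n\left(\left\lfloor\frac{|A_i|-k_i-1}{k}\right\rfloor-\left\lfloor\frac{k_i}{k}\right\rfloor\right)+1\right\}.$$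
   Context: $F^*=F\setminus\{0\}$. $\deg$ is the total degree (the zero polynomial $g=0$ is allowed), and $[x_1^{k_1}\cdots x_n^{k_n}]P(x_1,\ldots,x_n)$ is the coefficient of the monomial $x_1^{k_1}\cdots x_n^{k_n}$ in $P$. $p(F)$ denotes the additive order of the multiplicative identity of $F$: it equals the characteristic of $F$ if this is a prime, and $p(F)=+\infty$ if $F$ has characteristic zero (in which case $\min\{p(F)-c,\,x\}=x$ for integers $c,x$). *)

(* Defs.v *)
From HB Require Import structures.
(* mpoly must come before the MathComp-Analysis files: in the other order
   their notations have incompatible levels. *)
From mathcomp Require Export all_boot all_order all_algebra.
From mathcomp Require Export mpoly.
From mathcomp Require Export finmap boolp constructive_ereal.

Set Implicit Arguments.
Unset Strict Implicit.
Unset Printing Implicit Defensive.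

Import Order.TTheory GRing.Theory Num.Theory.

Local Open Scope ring_scope.

(* p(F), the additive order of 1 in F, is taken in the extended integers:
   it may be infinite, and p(F) - c (c an integer) may be negative. *)
Definition one_order (F : fieldType) : \bar int :=
  if pselect (exists m : nat, (0 < m)%N && (m%:R == 0 :> F)) is left h
  then (Posz (ex_minn h))%:E else +oo%E.

(* The values f(x), where x ranges over the product of the A i and
   P(x) != 0. *)
Definition restricted_value_set (n : nat) (F : fieldType)
    (f P : {mpoly F[n]}) (A : 'I_n -> {fset F}) : {fset F} :=
  [fset v in [seq f.@[fun i => val (x i)] |
              x : {dffun forall i : 'I_n, A i} <- enum predT
              & P.@[fun i => val (x i)] != 0]]%fset.

Lemma one_order_char0 (F : fieldType) :
  [pchar F] =i pred0 -> one_order F = +oo%E.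
Proof.
move=> h; rewrite /one_order; case: pselect => // hm.
have [m /andP[m0]] := hm; rewrite ((pcharf0P F).1 h m) => /eqP E.
by rewrite E in m0.
Qed.

Lemma one_order_pchar (F : fieldType) (p : nat) :
  p \in [pchar F] -> one_order F = (Posz p)%:E.
Proof.
move=> hp; rewrite /one_order; case: pselect => [h|[]]; last first.
  by exists p; rewrite prime_gt0 ?(pcharf_prime hp) // (pcharf0 hp) eqxx.
case: ex_minnP => m /andP[m0 hm] min; congr (Posz _)%:E; apply/eqP.
rewrite eqn_leq min ?prime_gt0 ?(pcharf_prime hp) ?(pcharf0 hp) //=.
by apply: dvdn_leq => //; rewrite (dvdn_pcharf hp).
Qed.

Lemma restricted_value_setP (n : nat) (F : fieldType)
    (f P : {mpoly F[n]}) (A : 'I_n -> {fset F}) (v : F) :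
  v \in restricted_value_set f P A <->
  exists x : 'I_n -> F,
    [/\ forall i, x i \in A i, P.@[x] != 0 & v = f.@[x]].
Proof.
split.
  rewrite in_fset => /mapP[/= x]; rewrite mem_filter => /andP[Px _] ->.
  by exists (fun i => val (x i)); split=> // i; apply: valP.
move=> [x [xA Px ->]].
pose y : {dffun forall i : 'I_n, A i} := [ffun i => FSetSub (xA i)].
have E : (fun i => val (y i)) = x by apply: funext => i; rewrite ffunE.
rewrite in_fset; apply/mapP; exists y; rewrite ?E //.
by rewrite mem_filter E Px mem_enum.
Qed.

(* Main.v *)
Require Import Defs.
From mathcomp Require Import ring zify.
Set Implicit Arguments.
Unset Strict Implicit.
Unset Printing Implicit Defensive.
Import Order.TTheory GRing.Theory Num.Theory.
Local Open Scope ring_scope.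

(** Let h = |V| and suppose that h is smaller than the asserted minimum.  The
    polynomial Q = P * \prod_(v in V) (f - v) vanishes on the whole grid
    \prod_i A_i: where P does not vanish, f takes a value in V.  A contradiction
    follows from the Combinatorial Nullstellensatz
    ([combinatorial_nullstellensatz]) once a monomial of top degree
    deg P + k h in Q is found whose exponents are < |A_i|.

    Only the leading form \sum_i a_i x_i^k of f contributes to the top degree,
    and multiplication by it preserves the residues mod k of all exponents.
    Write m = k q + r with 0 <= r_i < k, and keep the monomials with residue
    vector r: dividing exponents by k (the operation [slice]) turns the top part
    of P into a homogeneous polynomial p in y of degree
    d = \sum_i floor(m_i / k) with nonzero coefficient at y^q, and the top part
    of Q into S^h p, where S = \sum_i a_i y_i ([slice_prod]).  The exponent
    bound becomes N_i <= B_i with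
    B_i = floor((|A_i| - 1 - r_i) / k)
        = floor((|A_i| - m_i - 1) / k) + floor(m_i / k).
    So p is not in the ideal (y_i^(B_i + 1)), and it has to be shown that
    S^h p is not in it either.  The hypothesis on h says that
    h + 2 d <= \sum_i B_i and that 1, ..., h + d are nonzero in F.  The box can
    be shrunk to q <= b <= B with \sum_i b_i = h + 2 d exactly.

    What remains is a form of the strong Lefschetz property of the monomial
    complete intersection F[y] / (y_i^(b_i + 1)): multiplication by S^h is
    injective from degree d to the complementary degree d + h, as soon as
    (h + d)! is nonzero in F ([linformX_inj_mod_box_ideal]).  In characteristic
    zero this is the representation theory of sl2, with S as raising operator
    and an explicit second-order differential operator G as lowering operator.
    In positive characteristic complete reducibility fails, but the eigenvalues
    of C = S G suffice.  On degree d, \prod_(i <= d) (C - i (h + i + 1)) = 0,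
    because G^(d + 1) = 0; and modulo the ideal,
    \prod_(j < h) (C + (j + 1) (h - j)) kills every w with S^h w in the ideal.
    The difference of a root of the first product and one of the second is
      i (h + i + 1) + (j + 1) (h - j) = (i + j + 1) (h + i - j),
    with both factors between 1 and h + d, so the two products are coprime. *)

(** * The Combinatorial Nullstellensatz *)

(** Weights extracting the coefficient of degree j from univariate polynomials
    of degree at most j by sampling at j + 1 points: the Vandermonde matrix of
    distinct points is invertible. *)
Lemma moment_weights_exist (F : fieldType) (s : seq F) (j : nat) :
  uniq s -> (j < size s)%N ->
  exists w : nat -> F, forall e : nat, (e <= j)%N ->
    \sum_(t < j.+1) w t * s`_t ^+ e = (e == j)%:R.
Proof.
move=> us js; pose x : 'rV[F]_j.+1 := \row_t s`_t.
have V_unit : Vandermonde j.+1 x \in unitmx.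
  rewrite unitmxE det_Vandermonde unitfE; apply/prodf_neq0 => t _.
  apply/prodf_neq0 => u tu; rewrite !mxE subr_eq0 nth_uniq //.
  - by rewrite gtn_eqF.
  - exact: leq_trans (ltn_ord u) js.
  - exact: leq_trans (ltn_ord t) js.
pose w := invmx (Vandermonde j.+1 x) *m (delta_mx ord_max ord0 : 'cV[F]_j.+1).
exists (fun t => w (inord t) ord0) => e ej.
have /matrixP/(_ (inord e) ord0) :=
  mulKVmx V_unit (delta_mx ord_max ord0 : 'cV[F]_j.+1).
rewrite -/w !mxE eqxx andbT -val_eqE /= inordK // => <-.
by apply: eq_bigr => t _; rewrite !mxE inord_val inordK // mulrC.
Qed.

(** The products of the weights of [moment_weights_exist] express Q@_N as a
    linear combination of values of Q on the grid, which therefore cannot all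
    vanish. *)
Lemma combinatorial_nullstellensatz (n : nat) (F : fieldType) (Q : {mpoly F[n]})
    (N : 'X_{1..n}) (A : 'I_n -> {fset F}) :
  Q@_N != 0 -> (msize Q <= (mdeg N).+1)%N ->
  (forall i, (N i < #|` A i|)%N) ->
  exists2 x : 'I_n -> F, forall i, x i \in A i & Q.@[x] != 0.
Proof.
move=> QN degQ NA.
have [w wP] := boolp.choice (fun i => moment_weights_exist (fset_uniq (A i)) (NA i)).
pose D := (mdeg N).+1.
have ND i : ((N i).+1 <= D)%N by rewrite ltnS mdegE (bigD1 i) //= leq_addr.
(* The number of sample points varies with the coordinate; padding the weights
   by zero gives all coordinates the same index type. *)
pose W i (t : 'I_D) : F := if (t <= N i)%N then w i t else 0.
have WP i e : (e <= N i)%N -> \sum_(t < D) W i t * (A i)`_t ^+ e = (e == N i)%:R.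
  move=> eN; rewrite -(wP i e eN) (big_ord_widen D (fun t => w i t * (A i)`_t ^+ e)) //.
  rewrite [RHS]big_mkcond; apply: eq_bigr => t _.
  by rewrite /W ltnS; case: ifP; rewrite ?mul0r.
pose x (phi : {ffun 'I_n -> 'I_D}) i := (A i)`_(phi i).
have sumQ : \sum_(phi : {ffun 'I_n -> 'I_D}) (\prod_i W i (phi i)) * Q.@[x phi] = Q@_N.
  under eq_bigr do rewrite mevalE mulr_sumr.
  rewrite exchange_big /= (eq_big_seq (fun m => Q@_m * (m == N)%:R)).
    have [NQ|] := boolP (N \in msupp Q); last by rewrite -mcoeff_eq0 (negPf QN).
    rewrite (bigD1_seq N) ?msupp_uniq //= eqxx mulr1 big1 ?addr0 // => m.
    by move/negPf->; rewrite mulr0.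
  move=> /= m /[1!mcoeff_msupp] mQ.
  transitivity (Q@_m * \prod_i \sum_(t < D) W i t * (A i)`_t ^+ m i).
    rewrite bigA_distr_bigA mulr_sumr; apply: eq_bigr => phi _.
    by rewrite big_split /= mulrCA.
  congr (_ * _); have [->|mN] := eqVneq m N.
    by rewrite big1 // => i _; rewrite WP ?eqxx.
  (* As deg m <= deg N, a monomial m other than N falls below N somewhere,
     and the weights of that coordinate annihilate it. *)
  have [i mi] : exists i, (m i < N i)%N.
    apply/existsP; apply: contraNT mN; rewrite negb_exists => /forallP Nm.
    have {}Nm i : (N i <= m i)%N by rewrite leqNgt.
    have degm : (mdeg m <= mdeg N)%N.
      rewrite -ltnS; apply: leq_trans degQ; apply: msize_mdeg_lt.
      by rewrite mcoeff_msupp.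
    have NmE : (N <= m)%MM by apply/mnm_lepP.
    have /eqP : mdeg (m - N) = 0%N.
      move: degm; rewrite -{1}(submK NmE) mdegD -[leqRHS]add0n leq_add2r.
      by rewrite leqn0 => /eqP.
    by rewrite mdeg_eq0 => /eqP mN0; rewrite -(submK NmE) mN0 add0m.
  by rewrite (bigD1 i) //= WP ?(ltnW mi) // ltn_eqF // mul0r.
have /existsP[phi] : [exists phi : {ffun 'I_n -> 'I_D},
    (\prod_i W i (phi i)) * Q.@[x phi] != 0].
  apply: contraNT QN; rewrite negb_exists => /forallP Q0.
  by rewrite -sumQ big1 // => phi _; apply/eqP; rewrite -[_ == 0]negbK.
rewrite mulf_eq0 negb_or => /andP[/prodf_neq0 Wphi Qphi].
exists (x phi) => // i; apply: mem_nth; apply: leq_ltn_trans (NA i).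
by have := Wphi i isT; rewrite /W; case: ifP => //; rewrite eqxx.
Qed.

(** * The strong Lefschetz property of monomial complete intersections *)

Lemma mcoeffMX_if (n : nat) (R : comNzRingType) (p : {mpoly R[n]})
    (u N : 'X_{1..n}) :
  (p * 'X_[u])@_N = if (u <= N)%MM then p@_(N - u) else 0.
Proof.
case: ifP => [uN|/negbT uN].
  by rewrite -[in LHS](submK uN) mulrC -[RHS](mcoeffMX p u) addmC mulrC.
rewrite [p]mpolyE mulr_suml raddf_sum big1 //= => w _.
rewrite -scalerAl mcoeffZ -mpolyXD mcoeffX.
case: eqP => [E|]; last by rewrite mulr0.
by case/mnm_lepP: uN => i; rewrite -E mnmDE leq_addl.
Qed.

Lemma homogP (n : nat) (R : nzRingType) (p : {mpoly R[n]}) (s : nat) :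
  reflect (forall N, p@_N != 0 -> mdeg N = s) (p \is s.-homog).
Proof.
apply: (iffP (dhomogP _ _ _)) => hp N; have := hp N; by rewrite mcoeff_msupp.
Qed.

Section Lefschetz.

Variables (n : nat) (F : fieldType) (a : 'I_n -> F) (b : 'I_n -> nat).
Hypothesis a_neq0 : forall i, a i != 0.

Definition linform : {mpoly F[n]} := \sum_i a i *: 'X_i.

(** In one variable this sends y^N to N (b - N + 1) / a * y^(N - 1): the lowering
    operator of the lowest weight Verma module of sl2 whose (b + 1)-dimensional quotient is
    F[y] / (y^(b + 1)), rescaled to match the raising operator a y. *)
Definition lowering (p : {mpoly F[n]}) : {mpoly F[n]} :=
  \sum_i (a i)^-1%:MP * ((b i)%:R * p^`M(i) - 'X_i * p^`M(i)^`M(i)).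

(** Membership in the ideal generated by the 'X_i ^+ (b i).+1. *)
Definition in_box_ideal (p : {mpoly F[n]}) : Prop :=
  forall N : 'X_{1..n}, (forall i, (N i <= b i)%N) -> p@_N = 0.

Local Notation S := linform.
Local Notation G := lowering.
Local Notation I := in_box_ideal.

Lemma mderiv_linform i : S^`M(i) = (a i)%:MP.
Proof.
rewrite raddf_sum (bigD1 i) //= big1 ?addr0 => [|j ji]; rewrite mderivZ mderivX mnm1E.
  have -> : (U_(i) - U_(i) = 0 :> 'X_{1..n})%MM by apply/mnmP => j; rewrite !mnmE subnn.
  by rewrite eqxx scale1r mpolyX0 alg_mpolyC.
by rewrite (negPf ji) scale0r scaler0.
Qed.

Lemma mderiv_natM i (c : nat) (p : {mpoly F[n]}) :
  (c%:R * p)^`M(i) = c%:R * p^`M(i).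
Proof. by rewrite !mulr_natl mderivMn. Qed.

Lemma loweringD p q : G (p + q) = G p + G q.
Proof.
rewrite /lowering -big_split; apply: eq_bigr => i _ /=.
rewrite !mderivD; ring.
Qed.

Lemma lowering_natM (c : nat) p : G (c%:R * p) = c%:R * G p.
Proof.
rewrite /lowering mulr_sumr; apply: eq_bigr => i _ /=.
rewrite !mderiv_natM; ring.
Qed.

Lemma loweringB p q : G (p - q) = G p - G q.
Proof.
apply/eqP; rewrite eq_sym subr_eq -loweringD; apply/eqP; congr G; ring.
Qed.

Lemma euler_homog s (p : {mpoly F[n]}) : p \is s.-homog ->
  \sum_i 'X_i * p^`M(i) = s%:R * p.
Proof.
move=> /dhomogP hp; rewrite [in RHS](mpolyE p) mulr_sumr.
transitivity (\sum_i \sum_(m <- msupp p)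
    p@_m *: ('X_i * ((m i)%:R *: 'X_[F, m - U_(i)]))).
  apply: eq_bigr => i _; rewrite [in LHS](mpolyE p) raddf_sum mulr_sumr.
  by apply: eq_bigr => m _ /=; rewrite mderivZ mderivX -scalerAr.
rewrite exchange_big /=; apply: eq_big_seq => m mp.
rewrite -scaler_sumr -scalerAr; congr (_ *: _).
have <- : mdeg m = s := hp m mp.
rewrite mdegE natr_sum mulr_suml; apply: eq_bigr => i _.
rewrite -scalerAr -mpolyXD scaler_nat mulr_natl addmC.
case: (posnP (m i)) => [-> //|mi]; rewrite submK //.
by rewrite lep1mP -lt0n.
Qed.

(** The relation [G, S] = -H of sl2, where H acts on degree s as the scalar
    2 s - \sum_i b_i; the Euler identity turns the first-order part of the
    commutator into that scalar. *)
Lemma lowering_linformM s p : p \is s.-homog ->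
  G (S * p) = S * G p + (\sum_i b i)%:R * p - (2 * s)%:R * p.
Proof.
move=> hp; move: S mderiv_linform => T dT.
rewrite natrM -mulrA -(euler_homog hp) natr_sum mulr_suml /lowering !mulr_sumr.
rewrite -big_split -sumrB /=; apply: eq_bigr => i _.
have D1 : (T * p)^`M(i) = (a i)%:MP * p + T * p^`M(i) by rewrite mderivM dT.
have D2 : (T * p)^`M(i)^`M(i) = 2%:R * (a i)%:MP * p^`M(i) + T * p^`M(i)^`M(i).
  rewrite D1 mderivD mderiv_mulC mderivM dT; ring.
have aK : (a i)^-1%:MP * (a i)%:MP = 1 :> {mpoly F[n]}.
  by rewrite -mpolyCM mulVf.
rewrite D2 D1; ring: aK.
Qed.

Lemma homog_linform : S \is 1.-homog.
Proof. by apply: rpred_sum => i _; apply/dhomogZ; rewrite dhomogX; apply/eqP/mdeg1. Qed.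

Lemma homog_linformX j : S ^+ j \is j.-homog.
Proof. by rewrite -[X in X.-homog]mul1n; apply/dhomogMn/homog_linform. Qed.

Lemma homog_natM s (c : nat) (p : {mpoly F[n]}) : p \is s.-homog -> c%:R * p \is s.-homog.
Proof. by move=> hp; rewrite mulr_natl; apply: rpredMn. Qed.

(** The factor b i - N i explains the choice of [lowering]: it vanishes exactly
    on the faces N i = b i across which coefficients from outside the box could
    enter, whence [box_ideal_lowering]. *)
Lemma mcoeff_lowering p N :
  (G p)@_N = \sum_i (a i)^-1 * ((N i).+1%:R * ((b i)%:R - (N i)%:R)) * p@_(N + U_(i)).
Proof.
rewrite raddf_sum; apply: eq_bigr => i _ /=.
have dE q N' : q^`M(i)@_N' = (N' i).+1%:R * q@_(N' + U_(i)).
  by rewrite mcoeff_deriv mulr_natl.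
rewrite mcoeffCM mcoeffB ['X_i * _]mulrC mcoeffMX_if mulr_natl mcoeffMn.
rewrite -[_ *+ b i]mulr_natl !dE.
case: ifP => [/[dup] iN /submK NE|/negbT]; last first.
  by rewrite lep1mP negbK => /eqP ->; ring.
have -> : (N - U_(i) + U_(i) + U_(i) = N + U_(i))%MM by rewrite NE.
have -> : (N - U_(i) + U_(i))%MM i = N i by rewrite NE.
have -> : (N - U_(i))%MM i = (N i).-1 by rewrite mnmBE mnm1E eqxx subn1.
by rewrite prednK ?lt0n -?lep1mP //; ring.
Qed.

Lemma homog_lowering s p : p \is s.-homog -> G p \is s.-1.-homog.
Proof.
move=> /homogP hp; apply/homogP => N; rewrite mcoeff_lowering => pN.
have [i /hp] : exists i, p@_(N + U_(i)) != 0.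
  apply/existsP; apply: contraNT pN; rewrite negb_exists => /forallP p0.
  by rewrite big1 // => i _; have /eqP-> := negbNE (p0 i); rewrite mulr0.
by rewrite mdegD mdeg1 addn1 => <-.
Qed.

Lemma lowering_homog0 p : p \is 0.-homog -> G p = 0.
Proof.
move=> /homogP hp; apply/mpolyP => N; rewrite mcoeff_lowering mcoeff0 big1 // => i _.
have [->|/hp] := eqVneq p@_(N + U_(i)) 0; first by rewrite mulr0.
by rewrite mdegD mdeg1 addn1.
Qed.

Lemma box_idealD p q : I p -> I q -> I (p + q).
Proof. by move=> hp hq N Nb; rewrite mcoeffD hp // hq // addr0. Qed.

Lemma box_idealM p q : I p -> I (p * q).
Proof.
move=> hp; rewrite [q]mpolyE mulr_sumr => N Nb; rewrite raddf_sum big1 //= => m _.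
rewrite -scalerAr mcoeffZ mcoeffMX_if; case: ifP => mN; rewrite ?mulr0 // hp ?mulr0 //.
by move=> i; rewrite mnmBE; apply: leq_trans (leq_subr _ _) (Nb i).
Qed.

Lemma box_ideal_lowering p : I p -> I (G p).
Proof.
move=> hp N Nb; rewrite mcoeff_lowering big1 // => i _.
have [->|Ni] := eqVneq (N i) (b i); first by rewrite subrr !mulr0 mul0r.
rewrite hp ?mulr0 // => j; rewrite mnmDE mnm1E.
by have [<-|_] := eqVneq i j; rewrite ?addn0 // addn1 ltn_neqAle Ni Nb.
Qed.

Lemma box_ideal_natM (c : nat) p : c%:R != 0 :> F -> I (c%:R * p) -> I p.
Proof.
move=> c0 hp N Nb; have := hp N Nb; rewrite mulr_natl mcoeffMn -mulr_natr.
by move/eqP; rewrite mulf_eq0 (negPf c0) orbF => /eqP.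
Qed.

Lemma lowering_iterB j (c : nat) u v :
  iter j G (u - c%:R * v) = iter j G u - c%:R * iter j G v.
Proof.
by elim: j => [//|j IH]; rewrite !iterS IH loweringB lowering_natM.
Qed.

Lemma homog_iter_lowering s j p :
  p \is s.-homog -> iter j G p \is (s - j).-homog.
Proof.
move=> hp; elim: j => [|j hj]; first by rewrite subn0.
by rewrite subnS; apply: homog_lowering.
Qed.

Section Weight.
Variables (d h : nat).
Hypothesis middle : (\sum_i b i = h + 2 * d)%N.

(** On degree d, S G^(i + 1) = G^i (C - i (h + i + 1)) with C = S G.  So each
    factor C - i (h + i + 1) applied to w shortens by one the power of G that
    sends w into the ideal. *)
Lemma linform_iter_lowering i w : w \is d.-homog -> (i <= d)%N ->
  S * iter i.+1 G w = iter i G (S * G w - (i * (h + i).+1)%:R * w).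
Proof.
move=> hw; elim: i => [|i IH] lt_id; first by rewrite mul0n mul0r subr0.
have := lowering_linformM (homog_iter_lowering i.+1 hw); rewrite IH ?(ltnW lt_id) //= => E.
have -> : S * G (G (iter i G w)) =
   G (iter i G (S * G w - (i * (h + i).+1)%:R * w)) - (h + 2 * i.+1)%:R * iter i.+1 G w.
  rewrite E middle /=; have -> : d = ((d - i.+1) + i.+1)%N by rewrite subnK.
  rewrite addnK; ring.
rewrite !lowering_iterB !iterS !loweringB !lowering_natM; ring.
Qed.

(** On degree d, G S^(j + 1) = S^j (C + (j + 1) (h - j)) with C = S G. *)
Lemma lowering_linformX j w : w \is d.-homog ->
  G (S ^+ j.+1 * w) = S ^+ j * (S * G w + j.+1%:R * (h%:R - j%:R) * w).
Proof.
move=> hw; elim: j => [|j IH].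
  rewrite expr1 expr0 (lowering_linformM hw) middle; ring.
rewrite exprS -mulrA (lowering_linformM (s := j.+1 + d)); last first.
  exact: dhomogM (homog_linformX _) hw.
rewrite IH middle exprS; ring.
Qed.

Hypothesis small : forall t, (0 < t <= h + d)%N -> t%:R != 0 :> F.

(** If w is, modulo the ideal, an eigenvector of C with eigenvalue i (h + i + 1),
    then applying G to S^(j + 1) w gives (i + j + 1) (h + i - j) S^j w by
    [lowering_linformX].  This scalar is invertible, so the power of S can be
    lowered one step at a time. *)
Lemma eigen_descent i w : w \is d.-homog -> (i <= d)%N ->
  I (S * G w - (i * (h + i).+1)%:R * w) -> I (S ^+ h * w) -> I w.
Proof.
move=> hw le_id hI; suff H j : (j <= h)%N -> I (S ^+ j * w) -> I w by exact: H.
elim: j => [|j IH] jh; first by rewrite expr0 mul1r.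
move=> hj; apply: IH; first exact: ltnW.
apply: (@box_ideal_natM ((i + j).+1 * (h + i - j))).
  by rewrite natrM mulf_neq0 // small; lia.
have := box_idealD (box_ideal_lowering hj) (box_idealM (- S ^+ j) hI).
rewrite lowering_linformX //; congr I; rewrite (natrM _ (i + j).+1) natrB; last lia.
ring.
Qed.

(** Induction on a power i with G^i w in the ideal, starting from d + 1, since
    G^(d + 1) vanishes on degree d.  If G^(i + 1) w is in the ideal, then
    w' = C w - i (h + i + 1) w satisfies the hypotheses for i, so w' is in the
    ideal and [eigen_descent] applies to w. *)
Lemma linformX_inj_mod_box_ideal w : w \is d.-homog -> I (S ^+ h * w) -> I w.
Proof.
move=> hw hI.
suff H i v : v \is d.-homog -> (i <= d.+1)%N -> I (S ^+ h * v) -> I (iter i G v) -> I v.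
  apply: (H d.+1) => //; rewrite iterS lowering_homog0 => [N _|].
    by rewrite mcoeff0.
  by have := homog_iter_lowering d hw; rewrite subnn.
elim: i v => [//|i IH] v hv lt_id hI1 hI2.
have hSG : S * G v \is d.-homog.
  case: (posnP d) hv => [d0|d0] hv.
    rewrite lowering_homog0 ?mulr0 ?dhomog0 //.
    by apply/homogP => N /(homogP _ _ hv); rewrite d0.
  have := dhomogM homog_linform (homog_lowering hv).
  by rewrite add1n prednK.
apply: (@eigen_descent i) => //; apply: IH (ltnW lt_id) _ _.
- by apply: rpredB => //; apply: homog_natM.
- rewrite mulrBr; apply: box_idealD.
    (* The scalar in [lowering_linformX] is zero at j = h:
       S^h C v = G S^(h + 1) v. *)
    have := box_ideal_lowering (box_idealM S hI1).
    rewrite [_ * S]mulrC mulrA -exprS lowering_linformX //; congr I; ring.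
  have := box_idealM (- (i * (h + i).+1)%:R) hI1; congr I; ring.
- by rewrite -linform_iter_lowering // mulrC; apply: box_idealM.
Qed.

End Weight.

End Lefschetz.

(** * Splitting exponents into quotients and residues modulo k *)

Lemma msizeM_leq (n : nat) (F : fieldType) (p q : {mpoly F[n]}) :
  (msize (p * q) <= (msize p + msize q).-1)%N.
Proof.
have [->|p0] := eqVneq p 0; first by rewrite mul0r msize0.
have [->|q0] := eqVneq q 0; first by rewrite mulr0 msize0.
by rewrite msizeM.
Qed.

Lemma mcoeff_msize (n : nat) (F : fieldType) (p : {mpoly F[n]}) (N : 'X_{1..n}) :
  (msize p <= mdeg N)%N -> p@_N = 0.
Proof. by move=> pN; apply/eqP; rewrite mcoeff_eq0 msize_mdeg_ge. Qed.

Section Slice.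

Variables (n : nat) (F : fieldType) (k : nat) (r : 'X_{1..n}).

(** With the residue vector r fixed, this is the part of Q in degree
    k s + mdeg r, read as a form in the variables y_i = x_i^k after dividing by
    the monomial x^r. *)
Definition slice (s : nat) (Q : {mpoly F[n]}) : {mpoly F[n]} :=
  \sum_(q : 'X_{1..n < s.+1} | mdeg q == s) Q@_(q *+ k + r) *: 'X_[q].

Lemma mcoeff_slice s Q N :
  (slice s Q)@_N = if mdeg N == s then Q@_(N *+ k + r) else 0.
Proof.
rewrite raddf_sum /=; case: eqP => [Ns|Ns].
  have Nlt : (mdeg N < s.+1)%N by rewrite Ns.
  rewrite (bigD1 (BMultinom Nlt)) /= ?Ns // mcoeffZ mcoeffX eqxx mulr1.
  rewrite big1 ?addr0 // => q /andP[_ qN]; rewrite mcoeffZ mcoeffX.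
  by case: eqP => [E|]; rewrite ?mulr0 //; case/eqP: qN; apply: val_inj.
rewrite big1 // => q /eqP qs; rewrite mcoeffZ mcoeffX.
by case: eqP => [E|]; rewrite ?mulr0 //; case: Ns; rewrite -E.
Qed.

Lemma homog_slice s Q : slice s Q \is s.-homog.
Proof.
apply/homogP => N; rewrite mcoeff_slice.
by have [->|] := eqVneq (mdeg N) s; rewrite ?eqxx.
Qed.

Hypotheses (k_gt0 : (0 < k)%N) (r_lt : forall i, (r i < k)%N).

Variables (a : 'I_n -> F) (g : {mpoly F[n]}).
Hypothesis g_small : (msize g <= k)%N.
Let f := (\sum_(i < n) a i *: 'X_i ^+ k) + g.

Lemma msize_fM s Q : (msize Q <= (k * s + mdeg r).+1)%N ->
  (msize (f * Q) <= (k * s.+1 + mdeg r).+1)%N.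
Proof.
move=> hQ; apply: leq_trans (msizeM_leq _ _) _.
have hf : (msize f <= k.+1)%N.
  apply: leq_trans (msizeD_le _ _) _; rewrite geq_max (leqW g_small) andbT.
  apply: leq_trans (msize_sum _ _ _) _; apply/bigmax_leqP => i _.
  apply: leq_trans (msizeZ_le _ _) _.
  by rewrite mpolyXn msizeX mdegMn mdeg1 mul1n.
by rewrite mulnS; move: hf hQ; lia.
Qed.

(** The exponents of x_i^k are multiples of k, so the leading form of f acts on
    slices as the linear form; g contributes only in lower degree. *)
Lemma slice_fM s Q : (msize Q <= (k * s + mdeg r).+1)%N ->
  slice s.+1 (f * Q) = linform a * slice s Q.
Proof.
move=> hQ; apply/mpolyP => N; rewrite mcoeff_slice.
rewrite [linform a * _]mulr_suml raddf_sum /=.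
under eq_bigr do rewrite -scalerAl mcoeffZ ['X_(_) * _]mulrC mcoeffMX_if lep1mP mcoeff_slice.
case: eqP => [Ns|Ns]; last first.
  rewrite big1 // => i _; case: ifP => [Ni|_]; rewrite ?mulr0 //.
  rewrite ifF ?mulr0 //; apply/eqP => E; case: Ns.
  by rewrite -[N](@submK _ U_(i)) ?lep1mP // mdegD E mdeg1 addn1.
rewrite mulrDl mcoeffD [X in _ + X]mcoeff_msize ?addr0; last first.
  apply: leq_trans (msizeM_leq _ _) _.
  by rewrite mdegD mdegMn Ns; move: g_small hQ k_gt0; lia.
rewrite mulr_suml raddf_sum /=; apply: eq_bigr => i _.
rewrite -scalerAl mcoeffZ mpolyXn [_ * Q]mulrC mcoeffMX_if; congr (_ * _).
(* Both sides drop the same terms: as r i < k, the monomial x_i^k divides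
   x^(k N + r) exactly when y_i divides y^N. *)
have -> : (U_(i) *+ k <= N *+ k + r)%MM = (N i != 0%N).
  apply/mnm_lepP/idP => [/(_ i)|Ni j]; rewrite mnmDE !mulmnE mnm1E.
    by rewrite eqxx mul1n; have := r_lt i; case: (N i) => // h1 h2; lia.
  case: eqP => [<-|_]; rewrite ?mul0n // mul1n.
  by apply: leq_trans (leq_addr _ _); rewrite leq_pmull // lt0n.
case: ifP => // Ni; have NE : (N - U_(i) + U_(i) = N)%MM by rewrite submK // lep1mP.
rewrite ifT; last first.
  by apply/eqP; have := congr1 mdeg NE; rewrite mdegD mdeg1 Ns addn1 => -[].
congr (Q@__); apply/mnmP => j; rewrite !(mnmBE, mnmDE, mulmnE, mnm1E).
rewrite mulnBl; case: eqP => [<-|_]; last by rewrite !mul0n !subn0.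
by rewrite addnBAC // leq_mul2r lt0n Ni orbT.
Qed.

End Slice.

Lemma slice_prod (n : nat) (F : fieldType) (k : nat) (r : 'X_{1..n})
    (a : 'I_n -> F) (g P : {mpoly F[n]}) (vs : seq F) (s : nat) :
  (0 < k)%N -> (forall i, (r i < k)%N) -> (msize g <= k)%N ->
  (msize P <= (k * s + mdeg r).+1)%N ->
  let Q := (\prod_(v <- vs) ((\sum_i a i *: 'X_i ^+ k) + g - v%:MP)) * P in
  (msize Q <= (k * (s + size vs) + mdeg r).+1)%N /\
  slice k r (s + size vs) Q = linform a ^+ size vs * slice k r s P.
Proof.
move=> k0 rk gk hP /=; elim: vs => [|v vs [IH1 IH2]].
  by rewrite big_nil !mul1r addn0.
have gv : (msize (g - v%:MP) <= k)%N.
  apply: leq_trans (msizeD_le _ _) _; rewrite geq_max gk msizeN /=.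
  by rewrite msizeC; case: eqP.
rewrite /= addnS big_cons -mulrA -addrA; split; first exact: msize_fM.
by rewrite (slice_fM k0 rk) // IH2 mulrA exprS.
Qed.

(** * The lower bound *)

Lemma sum_between (n : nat) (lo hi : 'I_n -> nat) (t : nat) :
  (forall i, (lo i <= hi i)%N) ->
  (\sum_i lo i <= t)%N -> (t <= \sum_i hi i)%N ->
  exists b : 'I_n -> nat,
    (forall i, (lo i <= b i <= hi i)%N) /\ (\sum_i b i)%N = t.
Proof.
move=> lohi; elim: t => [|t IH] lot thi.
  exists lo; split=> [i|]; first by rewrite leqnn lohi.
  by apply/eqP; rewrite -leqn0.
move: lot; rewrite leq_eqVlt => /orP[/eqP lot|lot].
  by exists lo; split=> // i; rewrite leqnn lohi.
have [b [bP bt]] := IH lot (ltnW thi).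
have [i bi] : exists i, (b i < hi i)%N.
  apply/existsP; apply: contraLR thi; rewrite negb_exists => /forallP hb.
  by rewrite -leqNgt -bt; apply: leq_sum => i _; rewrite leqNgt.
exists (fun j => b j + (i == j))%N; split.
  by move=> j; have := bP j; case: eqP => [<-|_]; lia.
rewrite big_split /= bt (bigD1 i) //= eqxx big1 ?addn0 ?addn1 // => j.
by rewrite eq_sym => /negPf->.
Qed.

Lemma natr_neq0_one_order (F : fieldType) (h c t : nat) :
  ((Posz h)%:E < one_order F - (Posz c)%:E)%E ->
  (0 < t <= h + c)%N -> t%:R != 0 :> F.
Proof.
rewrite /one_order; case: pselect => [ex|nex] hc /andP[t0 tle]; apply/negP => tF.
  move: hc; case: ex_minnP => m _ /(_ t); rewrite t0 tF => /(_ isT) mt.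
  by rewrite -EFinB lte_fin; lia.
by case: nex; exists t; rewrite t0.
Qed.

Theorem theorem5p2 (n : nat) (F : fieldType) (k : nat)
    (a : 'I_n -> F) (f g P : {mpoly F[n]})
    (m : 'X_{1..n}) (A : 'I_n -> {fset F}) :
  (0 < n)%N ->
  (0 < k)%N ->
  (forall i, a i != 0) ->
  (msize g <= k)%N ->
  f = (\sum_(i < n) a i *: 'X_i ^+ k) + g ->
  P@_m != 0 ->
  (\sum_(i < n) m i)%N = (msize P).-1 ->
  (forall i, (m i < #|` A i|)%N) ->
  (mine (one_order F - (\sum_(i < n) Posz (m i %/ k)%N)%:E)
        (\sum_(i < n) (Posz ((#|` A i| - m i - 1) %/ k)%N
                       - Posz (m i %/ k)%N) + 1)%:E
   <= (Posz #|` restricted_value_set f P A|)%:E)%E.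
Proof.
move=> _ k0 a0 gk fE Pm degP mA.
set V := restricted_value_set f P A; set h := #|` V|.
pose q : 'X_{1..n} := [multinom (m i %/ k)%N | i < n].
pose r : 'X_{1..n} := [multinom (m i %% k)%N | i < n].
pose d := mdeg q.
have mE : (q *+ k + r)%MM = m.
  by apply/mnmP => i; rewrite mnmDE mulmnE !mnmE -divn_eq.
have r_lt i : (r i < k)%N by rewrite mnmE ltn_mod.
have dE : (\sum_i (m i %/ k) = d)%N.
  by rewrite /d mdegE; apply: eq_bigr => i _; rewrite mnmE.
have sumZ (c : 'I_n -> nat) : \sum_i Posz (c i) = Posz (\sum_i c i)%N.
  by rewrite (big_morph Posz PoszD (erefl _)).
rewrite leNgt sumrB !sumZ dE; apply/negP; rewrite lt_min => /andP[hp hB].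
(* The Lefschetz property needs a box whose size is exactly h + 2 d; it has to
   keep q inside. *)
pose B i := ((#|` A i| - r i - 1) %/ k)%N.
have BE i : B i = ((#|` A i| - m i - 1) %/ k + m i %/ k)%N.
  rewrite addnC -divnMDl // /B mnmE; congr (_ %/ _)%N.
  have := mA i; have := divn_eq (m i) k.
  by move: (m i) (m i %/ k * k)%N (m i %% k)%N => mi u v; lia.
have hB' : (h + 2 * d <= \sum_i B i)%N.
  rewrite (eq_bigr _ (fun i _ => BE i)) big_split /= dE.
  by move: hB; rewrite lte_fin; move: (\sum_i _)%N => X; lia.
have [b [qbB bsum]] : exists b : 'I_n -> nat,
    (forall i, (q i <= b i <= B i)%N) /\ (\sum_i b i = h + 2 * d)%N.
  apply: sum_between hB'; first by move=> i; rewrite BE mnmE leq_addl.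
  by rewrite -mdegE -/d; lia.
pose Q := (\prod_(v <- enum_fset V) (f - v%:MP)) * P.
have Pdeg : (msize P <= (k * d + mdeg r).+1)%N.
  have := congr1 mdeg mE; rewrite mdegD mdegMn -/d mulnC => ->.
  rewrite mdegE degP; exact: leqSpred.
have [Qdeg Qslice] := slice_prod a (enum_fset V) k0 r_lt gk Pdeg.
rewrite -/h -fE -/Q in Qdeg Qslice.
have [N Nb QN] : exists2 N : 'X_{1..n}, forall i, (N i <= b i)%N
    & (slice k r (d + h) Q)@_N != 0.
  apply: contrapT => noN; case/eqP: Pm.
  have := @linformX_inj_mod_box_ideal _ _ a b a0 d h bsum
    (fun t => natr_neq0_one_order hp) _ (homog_slice k r d P).
  rewrite -Qslice => /(_ _ q); rewrite mcoeff_slice eqxx mE; apply.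
    move=> N Nb; apply: contrapT => /eqP QN; apply: noN; by exists N.
  by move=> i; case/andP: (qbB i).
move: QN; rewrite mcoeff_slice.
have [NE QN|] := eqVneq (mdeg N) (d + h)%N; last by rewrite eqxx.
have [x xA] : exists2 x : 'I_n -> F, forall i, x i \in A i & Q.@[x] != 0.
  apply: combinatorial_nullstellensatz QN _ _ => [|i].
    by rewrite mdegD mdegMn NE mulnC.
  have /andP[_ bB] := qbB i; have NB := leq_trans (Nb i) bB.
  rewrite mnmDE mulmnE.
  have : (N i * k <= #|` A i| - r i - 1)%N by rewrite -leq_divRL.
  have := mA i; have : (r i <= m i)%N by rewrite mnmE leq_mod.
  lia.
rewrite mevalM mulf_eq0 negb_or rmorph_prod prodf_seq_neq0 /= => /andP[/allP fx Px].
have fV : f.@[x] \in V by apply/restricted_value_setP; exists x.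
have := fx _ fV.
by rewrite mevalB mevalC subrr eqxx.
Qed.
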